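(* Let $(X,d,A)$ be a metric pair such that $(X/A,\overline d_1)$ is uniformly discrete (so that $(K(X,A),\rho)$ is a discrete abelian group). Let $E$ be a complex Banach space and let $b=(b_h)_{h\in K(X,A)}$ be an element of $Z^1(K(X,A),\ell^\infty(K(X,A),E))$. Assume that for every $\lambda\in E^*$ the function $x\mapsto\lambda(b_x(0))$ belongs to $\operatorname{Hom}(K(X,A),\mathbb C)+B(K(X,A))$. Then the variety on $K(X,A)$ generated by the functions $x\mapsto\lambda(b_h(x))$, with $h\in K(X,A)$ and $\lambda\in E^*$, is synthesizable.
   Context: Virtual persistence diagrams. A metric pair $(X,d,A)$ is a metric space $(X,d)$ with a nonempty subset $A\subseteq X$. Let $q\colon X\to X/A$ collapse $A$ to one point $[A]$, put $d(x,A)=\inf_{a\in A}d(x,a)$, $d_1(x,y)=\min\{d(x,y),\,d(x,A)+d(y,A)\}$ and $\overline d_1(q(x),q(y))=d_1(x,y)$ on $X/A$. Uniformly discrete means that there is $\eta>0$ with $\overline d_1(u,v)\ge\eta$ for all distinct $u,v\in X/A$. $D(X)$ is the free commutative monoid on $X$, and $D(X,A)=D(X)/D(A)\cong D(X\setminus A)$. A matching between $\alpha,\beta\in D(X,A)$ is $\sigma=\sum_{i=1}^n(x_i,y_i)\in D(X\times X)$ with $\sum_i x_i=\alpha$ and $\sum_i y_i=\beta$ modulo $D(A)$; $W_1(\alpha,\beta)=\inf_\sigma\sum_i d_1(x_i,y_i)$. $K(X,A)$ is the Grothendieck group of $D(X,A)$ (elements $\alpha-\beta$) with the translation-invariant metric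 $\rho(\alpha-\beta,\gamma-\delta)=W_1(\alpha+\delta,\gamma+\beta)$. Cocycles. With $(\tau_k u)(x)=u(x+k)$, $Z^1(K(X,A),\ell^\infty(K(X,A),E))$ is the space of families $b=(b_h)_{h\in K(X,A)}$ of bounded functions $b_h\colon K(X,A)\to E$ with $b_{h+k}=\tau_k b_h+b_k$ for all $h,k$ and $\sup_{h\ne0}\|b_h\|_\infty/\rho(h,0)<\infty$. Harmonic analysis on a discrete abelian group $G$. $\widehat G$ is the compact group of homomorphisms $G\to\mathbb T$. $B(G)$ is the set of functions $x\mapsto\int_{\widehat G}\chi(x)\,d\mu(\chi)$ with $\mu$ a finite complex regular Borel measure on $\widehat G$. $\operatorname{Hom}(G,\mathbb C)$ is the space of additive functions $G\to\mathbb C$. $C(G)$ is the space of all functions $G\to\mathbb C$ with pointwise convergence. A variety on $G$ is a closed complex linear subspace of $C(G)$ invariant under all translations; the variety generated by a family is the smallest variety containing it. A polynomial is an element of the complex (unital) algebra generated by additive functions, an exponential is a homomorphism $m\colon G\to\mathbb C^\times$, and an exponential monomial is a product $p\,m$ of a polynomial $p$ and an exponential $m$. A variety is synthesizable if the exponential monomials it contains span a dense subspace of it. *)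

(* Defs.v *)
From HB Require Import structures.
From mathcomp Require Import all_boot all_order all_algebra generic_quotient.
From mathcomp Require Import finmap multiset.
From mathcomp Require Import complex.
From mathcomp Require Import all_classical all_reals all_analysis.
From mathcomp Require Import lra.

Set Implicit Arguments.
Unset Strict Implicit.
Unset Printing Implicit Defensive.

Import Order.TTheory GRing.Theory Num.Theory.
Import numFieldNormedType.Exports.

Local Open Scope quotient_scope.
Local Open Scope classical_set_scope.
Local Open Scope ring_scope.
Local Open Scope complex_scope.

Section metric_pair.
Context {R : realType} {X : metricType R} (A : set X).
Implicit Types x y z : X.

Definition dist_to x : R := inf [set mdist x a | a in A].

Definition d1 x y : R :=
  Num.min (mdist x y) (dist_to x + dist_to y).

Definition collapse_rel : rel X := fun x y => `[< x = y \/ A x /\ A y >].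

Lemma collapse_rel_refl : reflexive collapse_rel.
Proof. by move=> x; apply/asboolP; left. Qed.

Lemma collapse_rel_sym : symmetric collapse_rel.
Proof. by move=> x y; apply: asbool_equiv_eq; split=> -[->|[]]; auto. Qed.

Lemma collapse_rel_trans : transitive collapse_rel.
Proof.
move=> y x z /asboolP xy /asboolP yz; apply/asboolP.
by case: xy yz => [->|[Ax Ay]] // [<-|[_ Az]]; right.
Qed.

Canonical collapse_equiv :=
  EquivRel collapse_rel collapse_rel_refl collapse_rel_sym collapse_rel_trans.

Definition collapse : Type := {eq_quot collapse_equiv}.
HB.instance Definition _ := Choice.on collapse.
HB.instance Definition _ := EqQuotient.on collapse.

(* The choice of representatives is irrelevant: see d1barE. *)
Definition d1bar (u v : collapse) : R := d1 (repr u) (repr v).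

Definition uniformly_discrete : Prop :=
  exists2 eta : R, 0 < eta &
    forall u v : collapse, u != v -> eta <= d1bar u v.

Lemma dist_to_ge0 x : 0 <= dist_to x.
Proof.
have [A0|/set0P/negP/negPn/eqP A0] := pselect (A !=set0).
  by apply: lb_le_inf => [|_ [a _ <-]]; [exact: image_nonempty|exact: mdist_ge0].
by rewrite /dist_to A0 image_set0 inf0.
Qed.

Lemma dist_to_lb x a : A a -> dist_to x <= mdist x a.
Proof.
move=> Aa; apply: ge_inf; last by exists a.
by exists 0 => _ [b _ <-]; exact: mdist_ge0.
Qed.

Lemma dist_to_in x : A x -> dist_to x = 0.
Proof.
move=> Ax; apply/eqP; rewrite eq_le dist_to_ge0 andbT.
by rewrite (le_trans (dist_to_lb x Ax))// mdistxx.
Qed.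

Lemma dist_to_triangle x y : dist_to x <= mdist x y + dist_to y.
Proof.
have [A0|/set0P/negP/negPn/eqP A0] := pselect (A !=set0).
  rewrite -lerBlDl; apply: lb_le_inf => [|_ [a Aa <-]].
    exact: image_nonempty.
  by rewrite lerBlDl (le_trans (dist_to_lb x Aa))// metric_triangle.
by rewrite /dist_to A0 !image_set0 inf0 addr0 mdist_ge0.
Qed.

Lemma d1xx x : d1 x x = 0.
Proof. by rewrite /d1 mdistxx; apply/min_idPl; rewrite addr_ge0 ?dist_to_ge0. Qed.

Lemma d1_sym x y : d1 x y = d1 y x.
Proof. by rewrite /d1 metric_sym addrC. Qed.

Lemma d1_ge0 x y : 0 <= d1 x y.
Proof. by rewrite le_min mdist_ge0 addr_ge0 ?dist_to_ge0. Qed.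

Lemma d1_triangle x y z : d1 x z <= d1 x y + d1 y z.
Proof.
have := metric_triangle x y z.
have := dist_to_triangle x y; have := dist_to_triangle z y.
rewrite (metric_sym z y).
have := dist_to_ge0 y; have := dist_to_ge0 x; have := dist_to_ge0 z.
rewrite /d1 => z0 y0 x0 zy xy xz.
rewrite !minElt; do !case: ifPn; rewrite -?leNgt => *; lra.
Qed.

Lemma d1_collapsel x x' y :
  \pi_collapse x = \pi_collapse x' -> d1 x y = d1 x' y.
Proof.
move=> /eqmodP/asboolP[->//|[Ax Ax']].
rewrite /d1 (dist_to_in Ax) (dist_to_in Ax') !add0r.
have dl a : A a -> Num.min (mdist a y) (dist_to y) = dist_to y.
  by move=> Aa; apply/min_idPr; rewrite metric_sym dist_to_lb.
by rewrite !dl.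
Qed.

Lemma d1barE x y : d1bar (\pi x) (\pi y) = d1 x y.
Proof.
rewrite /d1bar (@d1_collapsel _ x) ?reprK// d1_sym.
by rewrite (@d1_collapsel _ y) ?reprK// d1_sym.
Qed.

End metric_pair.

Definition fcm (T : choiceType) : Type := {mset T}%mset.
Identity Coercion fcm_multiset : fcm >-> multiset_of.

Section fcm.
Context {T : choiceType}.

HB.instance Definition _ := Choice.on (fcm T).

Definition fcm_add (a b : fcm T) : fcm T := msetD a b.

HB.instance Definition _ := GRing.isNmodule.Build (fcm T)
  (@msetDA T : associative fcm_add) (@msetDC T : commutative fcm_add)
  (@mset0D T : left_id mset0 fcm_add).

Definition pt (x : T) : fcm T := [mset x]%mset.

End fcm.

Section fcm_theory.
Context {T : choiceType}.
Implicit Types (a b c : fcm T) (x y : T).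

Lemma fcm_addI : right_injective (@GRing.add (fcm T)).
Proof. by move=> a b c; exact: (can_inj (msetDKB a)). Qed.

Lemma fcm_addE a b x : (a + b : fcm T) x = (a x + b x)%N.
Proof. by rewrite [LHS]msetE2. Qed.

Lemma in_fcmD a b x : (x \in (a + b : fcm T)) = (x \in a) || (x \in b).
Proof. exact: in_msetD. Qed.

Lemma in_pt x y : (x \in pt y) = (x == y).
Proof. exact: in_mset1. Qed.

Lemma fcm_rem a x : x \in a -> exists b, a = pt x + b.
Proof. by move=> xa; exists (msetB a [mset x]%mset); rewrite [RHS](msetB1K xa). Qed.

Lemma fcm_ind (P : fcm T -> Prop) :
  P 0 -> (forall x a, P a -> P (pt x + a)) -> forall a, P a.
Proof.
move=> P0 Pa a; have -> : a = seq_mset a :> {mset T}%mset by rewrite seq_mset_id.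
elim: (enum_mset a) => [|x s IH].
  suff -> : seq_mset [::] = 0 :> fcm T by [].
  by apply/msetP => y; rewrite mset_seqE mset0E.
suff -> : seq_mset (x :: s) = pt x + seq_mset s :> fcm T by exact: Pa.
by apply/msetP => y; rewrite fcm_addE !mset_seqE/= msetnE eq_sym; case: eqP.
Qed.

Lemma fcm_bigD (V : nmodType) (F : T -> V) a b :
  \sum_(x <- (a + b : fcm T)) F x = \sum_(x <- a) F x + \sum_(x <- b) F x.
Proof.
rewrite -big_cat; apply: perm_big; apply/allP => x _ /=.
by rewrite count_cat !count_mem_mset fcm_addE.
Qed.

Lemma fcm_big1 (V : nmodType) (F : T -> V) x : \sum_(y <- pt x) F y = F x.
Proof. by rewrite /pt enum_msetn big_seq1. Qed.

End fcm_theory.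

Section diagrams.
Context {R : realType} {X : metricType R} (A : set X).
Implicit Types a b c : fcm X.

Definition fcm_on a : Prop := forall x, x \in a -> A x.

(* The congruence modulo the submonoid D(A) of the free commutative monoid
   D(X); the quotient is D(X, A). *)
Definition diag_rel : rel (fcm X) := fun a b =>
  `[< exists c d, [/\ fcm_on c, fcm_on d & a + c = b + d] >].

Lemma fcm_on0 : fcm_on 0.
Proof. by move=> x; rewrite in_mset0. Qed.

Lemma fcm_onD a b : fcm_on a -> fcm_on b -> fcm_on (a + b).
Proof. by move=> Aa Ab x; rewrite in_fcmD => /orP[/Aa|/Ab]. Qed.

Lemma diag_rel_refl : reflexive diag_rel.
Proof. by move=> a; apply/asboolP; exists 0, 0; split => //; exact: fcm_on0. Qed.

Lemma diag_rel_sym : symmetric diag_rel.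
Proof.
by move=> a b; apply: asbool_equiv_eq; split=> -[c [d [? ? ?]]]; exists d, c.
Qed.

Lemma diag_rel_trans : transitive diag_rel.
Proof.
move=> b a c /asboolP[a1 [b1 [Aa1 Ab1 e1]]] /asboolP[b2 [c2 [Ab2 Ac2 e2]]].
apply/asboolP; exists (a1 + b2), (b1 + c2); split; [exact: fcm_onD..|].
by rewrite addrA e1 addrAC e2 addrAC addrA.
Qed.

Canonical diag_equiv :=
  EquivRel diag_rel diag_rel_refl diag_rel_sym diag_rel_trans.

Definition diagrams : Type := {eq_quot diag_equiv}.
HB.instance Definition _ := Choice.on diagrams.
HB.instance Definition _ := EqQuotient.on diagrams.

Definition diag_class (a : fcm X) : diagrams := \pi a.

Definition diag_add (u v : diagrams) : diagrams := diag_class (repr u + repr v).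

Lemma diag_classP a b :
  diag_class a = diag_class b <->
  exists c d, [/\ fcm_on c, fcm_on d & a + c = b + d].
Proof. by split=> [/eqmodP/asboolP//|h]; apply/eqmodP/asboolP. Qed.

Lemma diag_class_repr (u : diagrams) : diag_class (repr u) = u.
Proof. exact: reprK. Qed.

Lemma diag_addE a b :
  diag_add (diag_class a) (diag_class b) = diag_class (a + b).
Proof.
have /diag_classP[c [d [Ac Ad e]]] := diag_class_repr (diag_class a).
have /diag_classP[c' [d' [Ac' Ad' e']]] := diag_class_repr (diag_class b).
apply/diag_classP; exists (c + c'), (d + d'); split; [exact: fcm_onD..|].
by rewrite addrACA e e' addrACA.
Qed.

Lemma diag_addA : associative diag_add.
Proof.
move=> u v w; rewrite -(diag_class_repr u) -(diag_class_repr v).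
by rewrite -(diag_class_repr w) !diag_addE addrA.
Qed.

Lemma diag_addC : commutative diag_add.
Proof. by move=> u v; rewrite /diag_add addrC. Qed.

Lemma diag_add0 : left_id (diag_class 0) diag_add.
Proof. by move=> u; rewrite -(diag_class_repr u) diag_addE add0r. Qed.

HB.instance Definition _ :=
  GRing.isNmodule.Build diagrams diag_addA diag_addC diag_add0.

Lemma diag_classD a b : diag_class (a + b) = diag_class a + diag_class b.
Proof. by rewrite [RHS]diag_addE. Qed.

Lemma diag_addI : right_injective (@GRing.add diagrams).
Proof.
move=> u v w; rewrite -(diag_class_repr u) -(diag_class_repr v).
rewrite -(diag_class_repr w) -!diag_classD => /diag_classP[c [d [Ac Ad]]].
by rewrite -!addrA => /fcm_addI e; apply/diag_classP; exists c, d.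
Qed.

(* The marginals of sigma are compared in D(X, A), that is, modulo D(A). *)
Definition matching (alpha beta : diagrams) (sigma : fcm (X * X)%type) : Prop :=
  diag_class (\sum_(p <- sigma) pt p.1) = alpha /\
  diag_class (\sum_(p <- sigma) pt p.2) = beta.

Definition cost (sigma : fcm (X * X)%type) : R :=
  \sum_(p <- sigma) d1 A p.1 p.2.

Definition W1 (alpha beta : diagrams) : R :=
  inf [set cost sigma | sigma in matching alpha beta].

Lemma cost_ge0 sigma : 0 <= cost sigma.
Proof. by apply: sumr_ge0 => p _; exact: d1_ge0. Qed.

Lemma costD s t : cost (s + t) = cost s + cost t.
Proof. exact: fcm_bigD. Qed.

Lemma cost_pt p : cost (pt p) = d1 A p.1 p.2.
Proof. exact: fcm_big1. Qed.

Lemma matchingD alpha beta gamma delta s t :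
  matching alpha beta s -> matching gamma delta t ->
  matching (alpha + gamma) (beta + delta) (s + t).
Proof. by move=> [<- <-] [<- <-]; split; rewrite fcm_bigD diag_classD. Qed.

Lemma matching_pt p :
  matching (diag_class (pt p.1)) (diag_class (pt p.2)) (pt p).
Proof. by split; rewrite fcm_big1. Qed.

Lemma diag_pt x : A x -> diag_class (pt x) = 0.
Proof.
move=> Ax; apply/diag_classP; exists 0, (pt x); split.
- exact: fcm_on0.
- by move=> y; rewrite in_pt => /eqP ->.
- by rewrite add0r addr0.
Qed.

Lemma in_sum_pt (f : X * X -> X) (s : fcm (X * X)%type) x :
  x \in (\sum_(p <- s) pt (f p) : fcm X) -> exists2 p, p \in s & f p = x.
Proof.
elim/(@fcm_ind (X * X)%type): s => [|p s IH].
  by rewrite enum_mset0 big_nil in_mset0.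
rewrite fcm_bigD fcm_big1 in_fcmD in_pt => /orP[/eqP ->|/IH[q qs qx]].
  by exists p => //; rewrite in_fcmD in_pt eqxx.
by exists q => //; rewrite in_fcmD qs orbT.
Qed.

Lemma diag_class_mem a b x :
  ~ A x -> diag_class a = diag_class (pt x + b) -> x \in a.
Proof.
move=> Ax /diag_classP[c [d [Ac Ad e]]].
have : x \in a + c by rewrite e !in_fcmD in_pt eqxx.
by rewrite in_fcmD => /orP[//|/Ac].
Qed.

Lemma matching_cancel x alpha beta s :
  matching (diag_class (pt x) + alpha) (diag_class (pt x) + beta) s ->
  exists2 t, matching alpha beta t & cost t <= cost s.
Proof.
have [Ax|Ax] := pselect (A x).
  by rewrite diag_pt// !add0r => h; exists s.
have rm t : matching (diag_class (pt x) + alpha) (diag_class (pt x) + beta)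
    (pt (x, x) + t) -> matching alpha beta t /\ cost (pt (x, x) + t) = cost t.
  move=> [h1 h2]; rewrite costD cost_pt/= d1xx add0r; split=> //; split.
    by apply: (@diag_addI (diag_class (pt x))); rewrite -h1 fcm_bigD fcm_big1
      diag_classD.
  by apply: (@diag_addI (diag_class (pt x))); rewrite -h2 fcm_bigD fcm_big1
    diag_classD.
have [/fcm_rem[t ->]|xxs] := boolP ((x, x) \in s).
  by move=> /rm[h e]; exists t; rewrite ?e.
move=> [h1 h2].
have [|[x1 y] ps /= x1E] := @in_sum_pt fst s x.
  apply: (@diag_class_mem _ (repr alpha) x Ax).
  by rewrite h1 diag_classD diag_class_repr.
have [|[z x2] qs /= x2E] := @in_sum_pt snd s x.
  apply: (@diag_class_mem _ (repr beta) x Ax).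
  by rewrite h2 diag_classD diag_class_repr.
subst x1 x2.
have [s' sE] := fcm_rem ps.
have qs' : (z, x) \in s'.
  move: qs; rewrite sE in_fcmD in_pt => /orP[/eqP[zx xy]|//].
  by move: xxs; rewrite [in X in X \notin _]xy -{1}xy ps.
have [t s'E] := fcm_rem qs'.
rewrite sE s'E in h1 h2 *.
exists (pt (z, y) + t); last first.
  rewrite !costD !cost_pt/= addrA lerD2r addrC; exact: d1_triangle.
split; apply: (@diag_addI (diag_class (pt x))).
  by rewrite -h1 !fcm_bigD !fcm_big1/= !diag_classD.
by rewrite -h2 !fcm_bigD !fcm_big1/= !diag_classD addrCA.
Qed.

Lemma W1_set_lb alpha beta :
  has_lbound [set cost sigma | sigma in matching alpha beta].
Proof. by exists 0 => _ [s _ <-]; exact: cost_ge0. Qed.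

(* every diagram is matched to the empty one through the basepoint of X/A *)
Lemma matching_exists alpha beta : A !=set0 ->
  [set cost sigma | sigma in matching alpha beta] !=set0.
Proof.
move=> [z Az].
have half1 u : exists s, matching u 0 s.
  rewrite -(diag_class_repr u); elim/(@fcm_ind X): (repr u) => [|x a [s hs]].
    by exists 0; split; rewrite enum_mset0 big_nil.
  exists (pt (x, z) + s); rewrite diag_classD -[0]addr0 -{1}(diag_pt Az).
  exact: matchingD (matching_pt (x, z)) hs.
have half2 u : exists s, matching 0 u s.
  rewrite -(diag_class_repr u); elim/(@fcm_ind X): (repr u) => [|x a [s hs]].
    by exists 0; split; rewrite enum_mset0 big_nil.
  exists (pt (z, x) + s); rewrite diag_classD -[0]addr0 -{1}(diag_pt Az).
  exact: matchingD (matching_pt (z, x)) hs.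
have [s hs] := half1 alpha; have [t ht] := half2 beta.
exists (cost (s + t)), (s + t) => //.
by rewrite -[alpha]addr0 -[beta]add0r; exact: matchingD.
Qed.

Lemma W1D alpha beta gamma : A !=set0 ->
  W1 (gamma + alpha) (gamma + beta) = W1 alpha beta.
Proof.
move=> A0; rewrite -(diag_class_repr gamma).
elim/(@fcm_ind X): (repr gamma) => [|x c IH]; first by rewrite !add0r.
rewrite -IH diag_classD -!addrA; apply/eqP; rewrite eq_le; apply/andP; split.
  apply: lb_le_inf => [|_ [s hs <-]]; first exact: matching_exists.
  apply: ge_inf; first exact: W1_set_lb.
  exists (pt (x, x) + s); last by rewrite costD cost_pt/= d1xx add0r.
  exact: matchingD (matching_pt (x, x)) hs.
apply: lb_le_inf => [|_ [s /matching_cancel[t ht ts] <-]].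
  exact: matching_exists.
by apply: le_trans ts; apply: ge_inf; [exact: W1_set_lb|exists t].
Qed.

End diagrams.

Section grothendieck.
Context {M : nmodType}.

Definition groth_rel : rel (M * M) := fun u v =>
  `[< exists k, u.1 + v.2 + k = v.1 + u.2 + k >].

Lemma groth_rel_refl : reflexive groth_rel.
Proof. by move=> u; apply/asboolP; exists 0. Qed.

Lemma groth_rel_sym : symmetric groth_rel.
Proof. by move=> u v; apply: asbool_equiv_eq; split=> -[k e]; exists k. Qed.

Lemma groth_rel_trans : transitive groth_rel.
Proof.
move=> v u w /asboolP[k e] /asboolP[l f]; apply/asboolP.
exists (v.1 + v.2 + k + l).
rewrite (AC (2*4) ((1*4*5)*(3*2*6)))/= e f.
by rewrite [LHS](AC (3*3) ((4*2)*(1*5*3*6))).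
Qed.

Canonical groth_equiv :=
  EquivRel groth_rel groth_rel_refl groth_rel_sym groth_rel_trans.

End grothendieck.

Definition groth (M : nmodType) : Type := {eq_quot @groth_equiv M}.

Section grothendieck_group.
Context {M : nmodType}.
Implicit Types (a b c d : M) (u v w : groth M).

HB.instance Definition _ := Choice.on (groth M).
HB.instance Definition _ := EqQuotient.on (groth M).

Definition groth_sub a b : groth M := \pi_(groth M) (a, b).

Definition groth_add u v : groth M :=
  groth_sub ((repr u).1 + (repr v).1) ((repr u).2 + (repr v).2).

Definition groth_opp u : groth M := groth_sub (repr u).2 (repr u).1.

Lemma groth_subP a b c d :
  groth_sub a b = groth_sub c d <-> exists k, a + d + k = c + b + k.
Proof. by split=> [/eqmodP/asboolP//|h]; apply/eqmodP/asboolP. Qed.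

Lemma groth_sub_repr u : groth_sub (repr u).1 (repr u).2 = u.
Proof. by rewrite /groth_sub -surjective_pairing reprK. Qed.

Lemma groth_addE a b c d :
  groth_add (groth_sub a b) (groth_sub c d) = groth_sub (a + c) (b + d).
Proof.
have /groth_subP[k e] := groth_sub_repr (groth_sub a b).
have /groth_subP[l f] := groth_sub_repr (groth_sub c d).
apply/groth_subP; exists (k + l).
by rewrite (AC (2*2*2) ((1*3*5)*(2*4*6)))/= e f (AC (3*3) (1*4*(2*5)*(3*6))).
Qed.

Lemma groth_oppE a b : groth_opp (groth_sub a b) = groth_sub b a.
Proof.
have /groth_subP[k e] := groth_sub_repr (groth_sub a b).
apply/groth_subP; exists k.
by rewrite [X in X + _]addrC -e [X in X + _]addrC.
Qed.

Lemma groth_addA : associative groth_add.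
Proof.
move=> u v w; rewrite -(groth_sub_repr u) -(groth_sub_repr v).
by rewrite -(groth_sub_repr w) !groth_addE !addrA.
Qed.

Lemma groth_addC : commutative groth_add.
Proof. by move=> u v; rewrite /groth_add addrC [X in groth_sub _ X]addrC. Qed.

Lemma groth_add0 : left_id (groth_sub 0 0) groth_add.
Proof. by move=> u; rewrite -(groth_sub_repr u) groth_addE !add0r. Qed.

Lemma groth_addN : left_inverse (groth_sub 0 0) groth_opp groth_add.
Proof.
move=> u; rewrite -(groth_sub_repr u) groth_oppE groth_addE.
by apply/groth_subP; exists 0; rewrite !addr0 add0r addrC.
Qed.

HB.instance Definition _ := GRing.isZmodule.Build (groth M)
  groth_addA groth_addC groth_add0 groth_addN.

Lemma groth_subD a b c d :
  groth_sub a b + groth_sub c d = groth_sub (a + c) (b + d).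
Proof. exact: groth_addE. Qed.

End grothendieck_group.

Section virtual_diagrams.
Context {R : realType} {X : metricType R} (A : set X).

(* K(X, A): its elements are the formal differences groth_sub alpha beta. *)
Definition virtual_diagrams : zmodType := groth (diagrams A).

(* The choice of representatives is irrelevant: see rhoE. *)
Definition rho (u v : virtual_diagrams) : R :=
  W1 ((repr u).1 + (repr v).2) ((repr v).1 + (repr u).2).

Lemma rhoE (alpha beta gamma delta : diagrams A) : A !=set0 ->
  rho (groth_sub alpha beta) (groth_sub gamma delta) =
  W1 (alpha + delta) (gamma + beta).
Proof.
move=> A0; rewrite /rho.
have /groth_subP[k e] := groth_sub_repr (groth_sub alpha beta).
have /groth_subP[l f] := groth_sub_repr (groth_sub gamma delta).
move: e f; move: (repr _) (repr _) => [c d] [a b]/=.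
rewrite !(addrC _ k) !(addrC _ l) => /diag_addI e /diag_addI f.
rewrite -(W1D _ _ (beta + delta))//.
rewrite -[RHS](W1D _ _ (b + d))//; congr W1.
  by rewrite [LHS](AC (2*2) ((3*1)*(2*4)))/= e [LHS](AC (2*2) ((2*4)*(1*3))).
by rewrite [LHS](AC (2*2) ((3*2)*(1*4)))/= f [LHS](AC (2*2) ((4*2)*(1*3))).
Qed.

End virtual_diagrams.

Section varieties.
Context {R : realType} {G : zmodType}.

(* C(G), with the topology of pointwise convergence; R[i]^o carries the norm
   topology of the complex numbers *)
Definition cfun : Type := {ptws G -> R[i]^o}.
HB.instance Definition _ := Topological.on cfun.

Implicit Types (f g : cfun) (F V : set cfun).

Definition linear_subspace V : Prop :=
  V (fun=> 0) /\
  forall (c : R[i]) f g, V f -> V g -> V (fun x => c * f x + g x).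

Definition variety V : Prop :=
  [/\ closed V, linear_subspace V &
      forall (k : G) f, V f -> V (fun x => f (x + k))].

Definition subalgebra V : Prop :=
  [/\ linear_subspace V, V (fun=> 1) &
      forall f g, V f -> V g -> V (fun x => f x * g x)].

Definition additive_fun : set cfun := [set f | forall x y, f (x + y) = f x + f y].

Definition polynomial_fun : set cfun := smallest subalgebra additive_fun.

Definition exponential_fun : set cfun :=
  [set m | (forall x, m x != 0) /\ forall x y, m (x + y) = m x * m y].

Definition exponential_monomial : set cfun :=
  [set f | exists p m, [/\ polynomial_fun p, exponential_fun m &
                           f = fun x => p x * m x]].

Definition synthesizable V : Prop :=
  V `<=` closure (smallest linear_subspace (V `&` exponential_monomial)).

End varieties.
Arguments cfun : clear implicits.

Record dual (R : realType) (G : zmodType) := Dual {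
  dual_fun :> G -> R[i] ;
  dual_norm : forall x, `|dual_fun x| = 1 ;
  dualD : {morph dual_fun : x y / x + y >-> x * y} }.

Section dual_topology.
Context {R : realType} {G : zmodType}.

HB.instance Definition _ := gen_eqMixin (dual R G).
HB.instance Definition _ := gen_choiceMixin (dual R G).

Lemma dual1_norm (x : G) : `|(1 : R[i])| = 1. Proof. exact: normr1. Qed.
Lemma dual1D : {morph (fun=> 1 : R[i]) : x y / (x + y : G) >-> x * y}.
Proof. by move=> x y; rewrite mulr1. Qed.

HB.instance Definition _ := isPointed.Build (dual R G) (Dual dual1_norm dual1D).

(* As G is discrete, the topology of the dual is that of pointwise convergence *)
HB.instance Definition _ := Topological.copy (dual R G)
  (initial_topology (fun chi : dual R G => (chi : G -> R[i]) : cfun R G)).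

End dual_topology.

Definition borel (T : ptopologicalType) : Type := g_sigma_algebraType (@open T).
HB.instance Definition _ (T : ptopologicalType) := Measurable.on (borel T).

Lemma hahn_pair d (T : measurableType d) (R : realType)
    (nu : {charge set T -> \bar R}) :
  {PN : set T * set T | hahn_decomposition nu PN.1 PN.2}.
Proof.
by apply/cid; have [P [N nuPN]] := Hahn_decomposition nu; exists (P, N).
Qed.

Section complex_measure.
Context d (T : measurableType d) (R : realType).

(* The integral of a real function against a finite signed measure nu is
   the difference of those against the parts of the Jordan decomposition of nu. *)
Definition charge_integral (nu : {charge set T -> \bar R}) (f : T -> R) : R :=
  let nuPN := proj2_sig (hahn_pair nu) in
  \int[jordan_pos nuPN]_x f x - \int[jordan_neg nuPN]_x f x.

(* A finite complex measure, given by its real and imaginary parts; charges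
   are countably additive and take finite values on measurable sets. *)
Record complex_measure := ComplexMeasure {
  re_part : {charge set T -> \bar R} ;
  im_part : {charge set T -> \bar R} }.

Implicit Types mu : complex_measure.

Definition complex_measure_fun mu (B : set T) : R[i] :=
  fine (re_part mu B) +i* fine (im_part mu B).
Coercion complex_measure_fun : complex_measure >-> Funclass.

Definition complex_integral mu (f : T -> R[i]) : R[i] :=
  let re x := complex.Re (f x) in
  let im x := complex.Im (f x) in
  (charge_integral (re_part mu) re - charge_integral (im_part mu) im) +i*
  (charge_integral (re_part mu) im + charge_integral (im_part mu) re).

Definition total_variation mu (B : set T) : \bar R :=
  ereal_sup [set (\sum_(0 <= n <oo) (complex.Re `|mu (F n)|)%:E)%E
            | F in [set F : (set T)^nat |
                     [/\ forall n, measurable (F n), trivIset setT F &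
                         \bigcup_n F n = B]]].

End complex_measure.

(* A complex measure is regular when its total variation is. *)
Definition regular_measure (R : realType) (T : ptopologicalType)
    (mu : complex_measure (borel T) R) : Prop :=
  forall B : set (borel T), measurable B ->
    total_variation mu B =
      ereal_inf [set total_variation mu U
                | U in [set U : set T | open U /\ B `<=` U]] /\
    total_variation mu B =
      ereal_sup [set total_variation mu K
                | K in [set K : set T | compact K /\ K `<=` B]].

(* B(G) *)
Definition fourier_stieltjes (R : realType) (G : zmodType) : set (cfun R G) :=
  [set f | exists2 mu : complex_measure (borel (dual R G)) R,
    regular_measure mu &
    f = fun x => complex_integral mu (fun chi => (chi : dual R G) x)].
Arguments fourier_stieltjes : clear implicits.

Section cocycles.
Context {R : realType} {G : zmodType} {E : normedModType R[i]}.

Definition sup_norm (f : G -> E) : R := sup [set complex.Re `|f x| | x in setT].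

(* Z^1(G, l^oo(G, E)), where r is the metric of G. *)
Definition lipschitz_cocycle (r : G -> G -> R) (b : G -> G -> E) : Prop :=
  [/\ forall h, bounded_fun (b h),
      forall h k x, b (h + k) x = b h (x + k) + b k x &
      has_ubound [set sup_norm (b h) / r h 0 | h in [set h | h != 0]]].

End cocycles.

(* Main.v *)
Require Import Defs.
From HB Require Import structures.
From mathcomp Require Import all_boot all_order all_algebra finmap.
From mathcomp Require Import complex.
From mathcomp Require Import all_classical all_reals all_analysis.
From mathcomp Require Import measurable_realfun ring lra.

Set Implicit Arguments.
Unset Strict Implicit.
Unset Printing Implicit Defensive.

Import Order.TTheory GRing.Theory Num.Theory.
Import numFieldNormedType.Exports.

Local Open Scope classical_set_scope.
Local Open Scope ring_scope.
Local Open Scope complex_scope.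

(** Fix a continuous functional lam and write lam (b_x(0)) = a(x) + f(x) with
a additive and f in B(G).  The cocycle identity b_h(x) = b_(h+x)(0) - b_x(0)
gives lam (b_h(x)) = a(h) + f(x + h) - f(x): the additive part survives only
as a constant, so every generator of the variety lies in B(G).  It remains to
see that a variety V generated by functions of B(G) is synthesizable, and in
fact the unitary characters in V already span a dense subspace
([eberlein_synthesizable]).

By duality ([bipolar]), the closure of a linear subspace W of C(G) consists of
the functions killed by every finitely supported measure on G that kills W.
So let phi be a finitely supported measure that kills the characters in V, and
let g be a generator; it must be shown that phi kills g
([eberlein_synthesis]).  A finitely supported measure s is the same thing as a
trigonometric polynomial chi |-> s(chi) on the dual group.  The measures that
kill V form an ideal I for convolution, V being translation invariant, and by
duality their common zeros on the dual are the characters in V, where phi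
vanishes.

Any such phi is a uniform limit of elements of I.  Given e > 0, the set of
characters where |phi| >= e is compact and I has no common zero on it, so
finitely many s_i in I satisfy max |s_i| > 1 there; then q = sum |s_i|^2 lies
in I, is nonnegative on the whole dual, and is at least 1 where |phi| >= e
([annihilator_bump]).  With M a bound of q, the product phi (1 - q/M)^n
differs from phi by an element of I and has sup norm at most e for large n.

The only property of g = int chi dmu that matters is Eberlein's inequality
|s(g)| <= c sup |s(chi)| ([fourier_stieltjes_eberlein]).  Applied to
phi (1 - q/M)^n, which takes the same value on g as phi does because g is in
V, it gives |phi(g)| <= c e for every e, hence phi(g) = 0. *)

(** * Finitely supported measures and duality in C(G) *)

Lemma continuous_lin (K : numFieldType) (T : topologicalType) (c : K)
    (u v : T -> K^o) : continuous u -> continuous v ->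
  continuous (fun x => c * u x + v x : K^o).
Proof.
move=> cu cv x; apply: cvgD; last exact: cv.
by apply: cvgM; [exact: cvg_cst|exact: cu].
Qed.
Section pairing.
Context {R : realType} {G : zmodType}.
Local Notation C := R[i].
Implicit Types (s t : seq (C * G)) (f g : cfun R G) (V W : set (cfun R G)).

(** The finitely supported measure sum_j c_j delta_(x_j), encoded by the list
of the (c_j, x_j), integrates f; these measures are the continuous dual of
C(G). *)
Definition pairing s f : C := \sum_(p <- s) p.1 * f p.2.

Lemma pairing_nil f : pairing [::] f = 0.
Proof. exact: big_nil. Qed.

Lemma pairing_cons p s f : pairing (p :: s) f = p.1 * f p.2 + pairing s f.
Proof. exact: big_cons. Qed.

Lemma pairing_cat s t f : pairing (s ++ t) f = pairing s f + pairing t f.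
Proof. exact: big_cat. Qed.

Lemma pairing_lin s c f g :
  pairing s (fun x => c * f x + g x) = c * pairing s f + pairing s g.
Proof.
rewrite mulr_sumr -big_split; apply: eq_bigr => p _ /=.
by rewrite mulrDr mulrCA.
Qed.

Lemma pairing_const0 s : pairing s (fun=> 0) = 0.
Proof. by apply: big1 => p _; rewrite mulr0. Qed.

Definition scale (c : C) s := [seq (c * p.1, p.2) | p <- s].

Lemma pairing_scale c s f : pairing (scale c s) f = c * pairing s f.
Proof.
by rewrite /pairing big_map mulr_sumr; apply: eq_bigr => p _; rewrite mulrA.
Qed.

Definition translate (k : G) s := [seq (p.1, p.2 + k) | p <- s].

Lemma pairing_translate k s f :
  pairing (translate k s) f = pairing s (fun x => f (x + k)).
Proof. by rewrite /pairing big_map. Qed.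

Definition convolution s t :=
  flatten [seq scale p.1 (translate p.2 t) | p <- s].

Lemma pairing_convolution s t f :
  pairing (convolution s t) f =
  \sum_(p <- s) p.1 * pairing t (fun x => f (x + p.2)).
Proof.
elim: s => [|p s IH]; first by rewrite big_nil pairing_nil.
by rewrite big_cons -IH pairing_cat pairing_scale pairing_translate.
Qed.

Definition annihilates V s := forall f, V f -> pairing s f = 0.

Lemma annihilates_convolution V s t : variety V ->
  annihilates V t -> annihilates V (convolution s t).
Proof.
move=> [_ _ Vshift] Vt f Vf; rewrite pairing_convolution big1// => p _.
by rewrite (Vt _ (Vshift _ _ Vf)) mulr0.
Qed.

(** The finite-dimensional separation theorem for the restrictions of W to xs,
by elimination of one point x at a time: either all elements of W vanish at x,
or some w1 in W has w1(x) = 1 and everything is reduced to the elements of W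
vanishing at x. *)
Lemma separate_on_points (xs : seq G) W f : linear_subspace W ->
  (forall w, W w -> ~ {in xs, w =1 f}) ->
  exists2 s, annihilates W s & pairing s f != 0.
Proof.
elim: xs W f => [|x xs IH] W f linW Wf.
  by have [W0 _] := linW; case: (Wf _ W0).
have [W0 WD] := linW.
have WZ c w : W w -> W (fun y => c * w y).
  by move=> Ww; have := WD c w _ Ww W0; under eq_fun do rewrite addr0.
have [[w1 [Ww1 w1x]]|Wx] := pselect (exists w, W w /\ w x = 1); last first.
  have {}Wx w : W w -> w x = 0.
    move=> Ww; have [//|wx0] := eqVneq (w x) 0.
    case: Wx; exists (fun y => (w x)^-1 * w y).
    by split; [exact: WZ|rewrite mulVf].
  have [fx0|fx0] := eqVneq (f x) 0.
    apply: (IH W) => // w Ww wf; apply: (Wf w Ww) => y.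
    by rewrite inE => /predU1P[->|/wf//]; rewrite Wx.
  exists [:: (1, x)] => [w Ww|]; rewrite pairing_cons pairing_nil/=;
    rewrite addr0 mul1r//.
  exact: Wx.
pose W' : set (cfun R G) := [set w | W w /\ w x = 0].
have linW' : linear_subspace W'.
  split; first by split.
  move=> c u v [Wu ux] [Wv vx]; split; first exact: WD.
  by rewrite ux vx mulr0 addr0.
have [||s W's sf] := IH W' (fun y => - f x * w1 y + f y) => //.
  move=> w [Ww wx0] wf; apply: (Wf (fun y => f x * w1 y + w y)).
    exact: WD.
  move=> y; rewrite inE => /predU1P[->|/wf ->].
    by rewrite w1x mulr1 wx0 addr0.
  by rewrite addrA mulNr subrr add0r.
(* w - w(x) w1 lies in W', so s(w) = w(x) s(w1) on W: the mass at x corrects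
   for this. *)
exists ((- pairing s w1, x) :: s).
  move=> w Ww; rewrite pairing_cons/=.
  have /W's : W' (fun y => - w x * w1 y + w y).
    by split; [exact: WD|rewrite w1x mulr1 addNr].
  by rewrite pairing_lin => <-; ring.
rewrite pairing_cons/=; move: sf; rewrite pairing_lin; apply: contra => /eqP <-.
by apply/eqP; ring.
Qed.

(** The sets of functions that agree with f on a finite set generate a filter
that converges to f pointwise. *)
Lemma nbhs_cfun_points f (B : set (cfun R G)) : nbhs f B ->
  exists xs : seq G, forall g : cfun R G, {in xs, g =1 f} -> B g.
Proof.
pose agree (xs : seq G) : set (cfun R G) :=
  [set g : cfun R G | {in xs, g =1 f}].
pose F := filter_from setT agree.
have FF : Filter F.
  apply: filter_from_filter => [|xs ys _ _]; first by exists [::].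
  exists (xs ++ ys) => // g fg.
  by split=> x xin; apply: fg; rewrite mem_cat xin ?orbT.
have Ff : F --> f.
  apply/cvg_sup => x U [V [[N oN <-] Nf] VU].
  exists [:: x] => // g gf; apply: VU; move: Nf.
  by rewrite /preimage/= (gf x (mem_head _ _)).
by move=> /Ff[xs _ xsB]; exists xs => g; exact: xsB.
Qed.

(** The Hahn-Banach theorem for C(G).  The topology being pointwise, it comes
down to finite sets of points, where no topology is left. *)
Lemma bipolar W f : linear_subspace W ->
  (forall s, annihilates W s -> pairing s f = 0) -> closure W f.
Proof.
move=> linW Wf B /nbhs_cfun_points[xs Bxs].
apply: contrapT => WB.
have [|s Ws] := @separate_on_points xs W f linW.
  by move=> w Ww wf; apply: WB; exists w; split => //; exact: Bxs.
by rewrite Wf ?eqxx.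
Qed.

Lemma point_continuous (x : G) : continuous (fun f : cfun R G => f x : C^o).
Proof. exact: (@proj_continuous G (fun=> C^o) x). Qed.

Lemma pairing_continuous s : continuous (fun f : cfun R G => pairing s f : C^o).
Proof.

elim: s => [|p s IH].
  have -> : pairing [::] = (fun _ : cfun R G => 0 : C^o).
    by apply/funext => g; rewrite pairing_nil.
  exact: (@cst_continuous (cfun R G) C^o 0).
have -> : pairing (p :: s) = (fun f : cfun R G => p.1 * f p.2 + pairing s f).
  by apply/funext => g; rewrite pairing_cons.
exact: (@continuous_lin C (cfun R G) p.1 (fun f => f p.2) (pairing s)
  (@point_continuous p.2) IH).
Qed.

End pairing.

(** * Topology of the complex numbers *)

Section complex_topology.
Context {R : realType}.
Local Notation C := R[i].

Lemma Re_norm (z : C) : (complex.Re `|z|)%:C = `|z|.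
Proof. exact/RRe_real/normr_real. Qed.

Lemma norm_real_complex (r : R) : `|r%:C| = `|r|%:C.
Proof. by rewrite normc_def/= expr0n addr0 sqrtr_sqr. Qed.

Lemma real_complexM (x y : R) : (x * y)%:C = x%:C * y%:C :> C.
Proof. exact: rmorphM. Qed.

Lemma real_complexD (x y : R) : (x + y)%:C = x%:C + y%:C :> C.
Proof. exact: rmorphD. Qed.

Lemma norm_i : `|'i%C : C| = 1.
Proof. by rewrite normc_def/= expr0n expr1n add0r sqrtr1. Qed.

Lemma normc_ge_Im (z : C) : `|complex.Im z|%:C <= `|z|.
Proof.
have := normc_ge_Re (z * 'i%C).
by rewrite ReiNIm normrN normrM norm_i mulr1.
Qed.

Lemma contraction_continuous (p : {additive C -> R}) :
  (forall z, `|p z|%:C <= `|z|) -> continuous (p : C^o -> R).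
Proof.
move=> pN z; apply/(@cvgrPdist_lt R R C^o _ (nbhs_filter (z : C^o))) => e e0.
have e0C : 0 < e%:C by rewrite ltcR.
have := nbhsx_ballx (z : C^o) _ e0C.
apply: (@filterS _ _ (nbhs_filter (z : C^o))) => w.
rewrite -ball_normE /= => zw.
by rewrite -ltcR; apply: le_lt_trans zw; rewrite -raddfB; exact: pN.
Qed.

Lemma Re_continuous : continuous (fun z : C^o => complex.Re z : R).
Proof. exact/contraction_continuous/normc_ge_Re. Qed.

Lemma Im_continuous : continuous (fun z : C^o => complex.Im z : R).
Proof. exact/contraction_continuous/normc_ge_Im. Qed.

Lemma Re_norm_continuous : continuous (fun z : C^o => complex.Re `|z| : R).
Proof.
move=> z; apply: (@continuous_comp C^o C^o R (fun z => `|z| : C^o)).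
  exact: norm_continuous.
exact: Re_continuous.
Qed.

Lemma real_complex_continuous : continuous (fun r : R => r%:C : C^o).
Proof.
move=> r; apply/cvgrPdist_lt => -[e e'].
rewrite ltcE /= => /andP[/eqP -> e0].
near=> t; rewrite -rmorphB norm_real_complex.
rewrite ltcR; near: t; exact: cvgr_dist_lt.
Unshelve. all: by end_near. Qed.

(** The disc is closed in the image of the square [-1, 1]^2. *)
Lemma disc_compact : compact [set z : C^o | `|z| <= 1].
Proof.
pose S := [set t : R | t \in `[-1, 1]%R].
pose h (p : R * R) : C^o := 'i%C * (p.2)%:C + (p.1)%:C.
have ch : continuous h.
  apply: continuous_lin => p.
    apply: (@continuous_comp (R * R)%type R C^o snd); first exact: cvg_snd.
    exact: real_complex_continuous.
  apply: (@continuous_comp (R * R)%type R C^o fst); first exact: cvg_fst.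
  exact: real_complex_continuous.
have cS : compact (h @` (S `*` S)).
  apply: continuous_compact; first exact: continuous_subspaceT.
  by apply: compact_setX; exact: segment_compact.
apply: subclosed_compact cS _.
  have -> : [set z : C^o | `|z| <= 1] =
      (fun z : C^o => complex.Re `|z|) @^-1` [set t : R | t <= 1].
    by apply/seteqP; split=> z /=; rewrite -lecR Re_norm.
  by apply: closed_comp => [z _|]; [exact: Re_norm_continuous|exact: closed_le].
move=> z z1; exists (complex.Re z, complex.Im z); last first.
  by rewrite /h addrC -complexE.
split; rewrite /S/= in_itv/= -ler_norml -lecR.
  exact: le_trans (normc_ge_Re z) z1.
exact: le_trans (normc_ge_Im z) z1.
Qed.

End complex_topology.

(** * Unitary characters and trigonometric polynomials *)

Section characters.
Context {R : realType} {G : zmodType}.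
Local Notation C := R[i].
Implicit Types (s t : seq (C * G)) (f g chi : cfun R G).

Definition character : set (cfun R G) :=
  [set chi | (forall x, `|chi x| = 1) /\
             (forall x y, chi (x + y) = chi x * chi y)].

(** The characters form a closed subset of a product of discs. *)
Lemma character_compact : compact character.
Proof.
have box : compact [set f : cfun R G | forall x, `|f x| <= 1].
  exact: (@tychonoff G (fun=> C^o) (fun=> [set z : C^o | `|z| <= 1])
    (fun=> disc_compact)).
have -> : character = [set f : cfun R G | forall x, `|f x| <= 1] `&`
   (\bigcap_(x : G) (fun f : cfun R G => `|f x| : C^o) @^-1` [set 1] `&`
    \bigcap_(p : G * G)
      (fun f : cfun R G => f (p.1 + p.2) - f p.1 * f p.2 : C^o) @^-1` [set 0]).
  apply/seteqP; split=> [chi [chi1 chiD]|chi [_ [chi1 chiD]]].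
    split; first by move=> x; rewrite chi1.
    by split=> [x _|[x y] _] /=; [exact: chi1|rewrite chiD subrr].
  split=> [x|x y]; first exact: chi1.
  exact: subr0_eq (chiD (x, y) I).
have cl1 (z : C^o) : closed [set z].
  exact/accessible_closed_set1/hausdorff_accessible/norm_hausdorff.
apply: compact_closedI => //; apply: closedI; apply: closed_bigI => p _;
  apply: closed_comp => // f _.
  apply: (@continuous_comp (cfun R G) C^o C^o (fun f => f p)
    (fun z => `|z| : C^o)).
    exact: point_continuous.
  exact: norm_continuous.
have e x := @point_continuous R G x f.
exact: (@cvgB C C^o (cfun R G) (nbhs f) (nbhs_filter f) _ _ _ _ (e _)
  (@cvgM C (cfun R G) (nbhs f) (nbhs_filter f) _ _ _ _ (e p.1) (e p.2))).
Qed.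

(* The equivalence of compactness with the finite subcover property is stated
   for pointed spaces. *)
HB.instance Definition _ := isPointed.Build (cfun R G) (fun=> 0).

Lemma character_exponential chi : character chi -> exponential_fun chi.
Proof.
by move=> [chi1 chiD]; split=> // x; rewrite -normr_eq0 chi1 oner_eq0.
Qed.

Lemma character_opp chi x : character chi -> chi (- x) = (chi x)^*%C.
Proof.
move=> [chi1 chiD].
have chi_neq0 y : chi y != 0 by rewrite -normr_eq0 chi1 oner_eq0.
have chi0 : chi 0 = 1 by apply: (mulfI (chi_neq0 0)); rewrite -chiD addr0 mulr1.
have := invc_norm (chi x); rewrite chi1 expr1n invr1 mul1r => <-.
by apply: (mulIf (chi_neq0 x)); rewrite -chiD addNr mulVf.
Qed.

Lemma pairing_translate_character k s chi : character chi ->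
  pairing (translate k s) chi = chi k * pairing s chi.
Proof.
move=> [_ chiD]; rewrite pairing_translate /pairing mulr_sumr.
by apply: eq_bigr => p _; rewrite chiD; ring.
Qed.

Lemma pairing_convolution_character s t chi : character chi ->
  pairing (convolution s t) chi = pairing s chi * pairing t chi.
Proof.
move=> chic; rewrite pairing_convolution [pairing s chi]/pairing mulr_suml.
apply: eq_bigr => p _; rewrite -mulrA; congr (_ * _).
by rewrite -pairing_translate pairing_translate_character.
Qed.

(** The trigonometric polynomial of the adjoint is the complex conjugate. *)
Definition adjoint s := [seq (p.1^*%C, - p.2) | p <- s].

Lemma pairing_adjoint_character s chi : character chi ->
  pairing (adjoint s) chi = (pairing s chi)^*%C.
Proof.
move=> chic; rewrite /pairing big_map rmorph_sum; apply: eq_bigr => p _ /=.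
by rewrite character_opp// rmorphM.
Qed.

(** The total variation, an upper bound for the sup norm of the trigonometric
polynomial; it is real-valued, unlike the norm of C. *)
Definition mass s : R := \sum_(p <- s) complex.Re `|p.1|.

Lemma mass_ge0 s : 0 <= mass s.
Proof. by apply: sumr_ge0 => p _; rewrite -lecR Re_norm normr_ge0. Qed.

Lemma le_pairing_mass s chi : character chi -> `|pairing s chi| <= (mass s)%:C.
Proof.
move=> [chi1 _]; rewrite /mass rmorph_sum/=.
apply: le_trans (ler_norm_sum _ _ _) _.
by apply: ler_sum => p _; rewrite normrM chi1 mulr1 Re_norm.
Qed.

End characters.

(** * Spectral synthesis for functions satisfying Eberlein's inequality *)

Section synthesis.
Context {R : realType} {G : zmodType}.
Local Notation C := R[i].
Implicit Types (s t : seq (C * G)) (f g chi : cfun R G) (F V : set (cfun R G)).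

(** A character at which all the measures killing V vanish belongs to V, by
duality; so these measures have no common zero on the compact set of
characters where phi is at least e in modulus.  A sum of finitely many of
their squared moduli, again the values of a measure killing V, is therefore
bounded below on this set. *)
Lemma annihilator_bump V (phi : seq (C * G)) (e : R) : variety V -> 0 < e ->
  (forall chi, V chi -> character chi -> pairing phi chi = 0) ->
  exists2 q, annihilates V q & forall chi, character chi ->
    0 <= pairing q chi /\ (e%:C <= `|pairing phi chi| -> 1 <= pairing q chi).
Proof.
move=> varV e0 phiV; have [clV linV _] := varV.
have Re_norm_pairing s :
    continuous (fun f : cfun R G => complex.Re `|pairing s f|).
  move=> f; apply: (@continuous_comp (cfun R G) C^o R (pairing s)
    (fun z => complex.Re `|z|)).
    exact: pairing_continuous.
  exact: Re_norm_continuous.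
pose K : set (cfun R G) :=
  character `&` [set f | e <= complex.Re `|pairing phi f|].
have cK : compact K.
  apply: compact_closedI; first exact: character_compact.
  apply: (@closed_comp _ _ (fun f : cfun R G => complex.Re `|pairing phi f|)
    [set r | e <= r]).
    by move=> f _; exact: Re_norm_pairing.
  exact: closed_ge.
pose U s : set (cfun R G) := [set f | 1 < complex.Re `|pairing s f|].
have [D DV KD] : finite_subset_cover (annihilates V) U K.
  have := cK; rewrite (@compact_cover (cfun R G)); apply.
    move=> s _; apply: (@open_comp _ _
      (fun f : cfun R G => complex.Re `|pairing s f|) [set r | 1 < r]).
      by move=> f _; exact: Re_norm_pairing.
    exact: open_gt.
  move=> chi [chic echi].
  have [s Vs schi] : exists2 s, annihilates V s & pairing s chi != 0.
    apply: contrapT => nos.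
    have /clV Vchi : closure V chi.
      apply: bipolar => // s Vs; apply: contrapT => /eqP schi.
      by apply: nos; exists s.
    have : e <= complex.Re `|pairing phi chi| := echi.
    by rewrite phiV// normr0/= leNgt e0.
  (* Scaling s makes its value at chi equal to 2, which exceeds 1. *)
  exists (scale (2 / pairing s chi) s).
    by move=> f Vf; rewrite pairing_scale (Vs f Vf) mulr0.
  rewrite /U.
  change (1 < complex.Re `|pairing (scale (2 / pairing s chi) s) chi|).
  by rewrite pairing_scale divfK// -ltcR Re_norm normr_nat ltr1n.
pose q := flatten [seq convolution (adjoint s) s | s <- (D : seq _)].
have qE f : pairing q f = \sum_(s <- D) pairing (convolution (adjoint s) s) f.
  rewrite /q; elim: (D : seq _) => [|s l IH].
    by rewrite big_nil pairing_nil.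
  by rewrite big_cons -IH pairing_cat.
have qc chi : character chi ->
    pairing q chi = \sum_(s <- D) `|pairing s chi| ^+ 2.
  move=> chic; rewrite qE; apply: eq_bigr => s _.
  rewrite pairing_convolution_character// pairing_adjoint_character//.
  by rewrite mulrC sqr_normc.
exists q.
  move=> f Vf; rewrite qE big_seq big1// => s sD.
  by apply: (annihilates_convolution _ varV) Vf; exact/set_mem/DV.
move=> chi chic; rewrite qc//; split.
  by apply: sumr_ge0 => s _; exact: exprn_ge0.
rewrite -Re_norm lecR => echi.
have [s /= sD schi] : cover [set` D] U chi by apply: KD; split.
rewrite (big_fsetD1 s)//= -[1]addr0 lerD//; last first.
  by apply: sumr_ge0 => t _; exact: exprn_ge0.
by rewrite exprn_ege1// -Re_norm lecR; exact: ltW.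
Qed.

(** Eberlein's inequality: s(chi) |-> s(g) is bounded for the sup norm on
trigonometric polynomials.  It characterizes B(G), and isolates what is used
of the measure representing g. *)
Definition eberlein g := exists2 c : R, 0 <= c &
  forall s (M : R), (forall chi, character chi -> `|pairing s chi| <= M%:C) ->
    `|pairing s g| <= (c * M)%:C.

(** The measures phi (1 - q/M)^n all take the same value at g, since q kills
V, while their sup norm on the characters becomes at most e: where |phi| < e
the factor is at most 1, and elsewhere q >= 1. *)
Lemma eberlein_synthesis V g (phi : seq (C * G)) : variety V -> V g ->
  eberlein g ->
  (forall chi, V chi -> character chi -> pairing phi chi = 0) ->
  pairing phi g = 0.
Proof.
move=> varV Vg [c c0 gc] phiV.
suff small (e : R) : 0 < e -> complex.Re `|pairing phi g| <= c * e.
  apply/eqP; rewrite -normr_eq0 -Re_norm.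
  suff /le_anti -> :
    complex.Re `|pairing phi g| <= 0 <= complex.Re `|pairing phi g| by [].
  rewrite -[X in _ && X]lecR Re_norm normr_ge0 andbT leNgt; apply/negP.
  set t := complex.Re _ => t0.
  have c10 : 0 < c + 1 by lra.
  have := small (t / (c + 1)) (divr_gt0 t0 c10).
  rewrite mulrA ler_pdivlMr//; nra.
move=> e0; have [q Vq qchi] := annihilator_bump varV e0 phiV.
pose M := mass q + 1; have q0 := mass_ge0 q; have M0 : 0 < M by rewrite /M; lra.
have M1 : 1 <= M by rewrite /M; lra.
pose p n := iter n (fun s => s ++ scale (- (M^-1)%:C) (convolution s q)) phi.
have pg n : pairing (p n) g = pairing phi g.
  elim: n => //= n IH; rewrite pairing_cat pairing_scale IH.
  by rewrite (annihilates_convolution _ varV Vq Vg) mulr0 addr0.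
have pchi n chi : character chi ->
    pairing (p n) chi = pairing phi chi * (1 - (M^-1)%:C * pairing q chi) ^+ n.
  move=> chic; elim: n => [|n IH] /=; first by rewrite expr0 mulr1.
  rewrite pairing_cat pairing_scale pairing_convolution_character// IH exprS.
  by ring.
have [n hn] : exists n, mass phi * (1 - M^-1) ^+ n <= e.
  have Mi : 0 < M^-1 <= 1 by rewrite invr_gt0 M0 invf_le1.
  have r1 : `|1 - M^-1| < 1 by rewrite ger0_norm; lra.
  have /cvgr_le : mass phi * (1 - M^-1) ^+ n @[n --> \oo] --> mass phi * 0.
    by apply: cvgMr; exact: cvg_expr.
  rewrite mulr0 => /(_ _ e0)[n _ hn]; exists n; exact: hn (leqnn n).
rewrite -lecR Re_norm -(pg n); apply: gc => chi chic.
have [qchi0 qchi1] := qchi _ chic.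
have qM : pairing q chi <= M%:C.
  rewrite -(ger0_norm qchi0) (le_trans (le_pairing_mass _ chic))// lecR /M; lra.
rewrite pchi//; set x : C := 1 - _.
have MC : 0 < M%:C by rewrite ltcR.
have MV : (M^-1)%:C = (M%:C)^-1 by rewrite fmorphV.
have x0 : 0 <= x by rewrite subr_ge0 MV mulrC ler_pdivrMr// mul1r.
have x1 : x <= 1 by rewrite gerBl mulr_ge0// MV invr_ge0 ltW.
rewrite normrM normrX (ger0_norm x0).
have [ephi|phie] := leP e (complex.Re `|pairing phi chi|); last first.
  rewrite -[leRHS]mulr1 ler_pM ?normr_ge0 ?exprn_ge0 ?exprn_ile1//.
  by rewrite -Re_norm lecR ltW.
apply: (@le_trans _ _ ((mass phi * (1 - M^-1) ^+ n)%:C)); last by rewrite lecR.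
rewrite rmorphM rmorphXn rmorphB/= ler_pM ?normr_ge0 ?exprn_ge0//.
  exact: le_pairing_mass.
apply: lerXn2r; rewrite ?nnegrE//; first by rewrite subr_ge0 lecR invf_le1.
apply: lerB => //; apply: ler_peMr; first by rewrite MV invr_ge0 ltW.
by apply: qchi1; rewrite -Re_norm lecR.
Qed.

Lemma eberlein_cst (c : C) : eberlein (fun _ : G => c).
Proof.
exists (complex.Re `|c|); first by rewrite -lecR Re_norm normr_ge0.
move=> s M sM; rewrite real_complexM Re_norm.
have char1 : @character R G (fun=> 1) by split=> *; rewrite ?normr1 ?mulr1.
have := pairing_lin s c (fun=> 1) (fun=> 0).
under eq_fun do rewrite mulr1 addr0.
by move=> ->; rewrite pairing_const0 addr0 normrM ler_wpM2l// sM.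
Qed.

Lemma eberlein_translate k f : eberlein f -> eberlein (fun x => f (x + k)).
Proof.
move=> [c c0 fc]; exists c => // s M sM; rewrite -pairing_translate.
apply: fc => chi chic; rewrite pairing_translate_character//.
by rewrite normrM chic.1 mul1r sM.
Qed.

Lemma eberlein_lin z f g : eberlein f -> eberlein g ->
  eberlein (fun x => z * f x + g x).
Proof.
move=> [c c0 fc] [d d0 gd].
have z0 : 0 <= complex.Re `|z| by rewrite -lecR Re_norm normr_ge0.
exists (complex.Re `|z| * c + d); first by rewrite addr_ge0// mulr_ge0.
move=> s M sM; rewrite pairing_lin (le_trans (ler_normD _ _))//.
rewrite mulrDl -mulrA real_complexD real_complexM Re_norm normrM lerD ?gd//.
by rewrite ler_wpM2l ?fc.
Qed.

Lemma smallest_linear_subspace F : linear_subspace (smallest linear_subspace F).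
Proof.
split=> [V [[V0 _] _]//|c f g Ff Fg V VF].
by have [[_ VD] _] := VF; apply: VD; [exact: Ff|exact: Fg].
Qed.

Lemma smallest_variety F : variety (smallest variety F).
Proof.
split.
- by apply: closed_bigI => V [[]].
- split=> [V [[_ [V0 _] _] _]//|c f g Ff Fg V VF].
  by have [[_ [_ VD] _] _] := VF; apply: VD; [exact: Ff|exact: Fg].
- move=> k f Ff V VF; have [[_ _ Vt] _] := VF; apply: Vt; exact: Ff.
Qed.

Lemma character_exponential_monomial (chi : cfun R G) : character chi ->
  exponential_monomial chi.
Proof.
move=> chic; exists (fun=> 1), chi; split.
- by move=> V [[_ V1 _] _].
- exact: character_exponential.
- by apply/funext => x; rewrite mul1r.
Qed.

(** The functions killed by all measures that kill the characters in V form a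
variety; it contains the generators, hence V. *)
Lemma eberlein_synthesizable F : (forall g, F g -> eberlein g) ->
  synthesizable (smallest variety F).
Proof.
move=> eF; set V := smallest variety F.
have varV : variety V := smallest_variety F.
pose kills s := forall chi, V chi -> character chi -> pairing s chi = 0.
pose P : set (cfun R G) := [set f | forall s, kills s -> pairing s f = 0].
have varP : variety P.
  split.
  - have -> : P = \bigcap_(s in kills) [set f | pairing s f = 0].
      by apply/seteqP; split.
    apply: closed_bigI => s _.
    apply: (@closed_comp (cfun R G) C^o (pairing s) [set 0]).
      by move=> f _; exact: pairing_continuous.
    exact/accessible_closed_set1/hausdorff_accessible/norm_hausdorff.
  - split=> [s _|c f g Pf Pg s ks]; first exact: pairing_const0.
    by rewrite pairing_lin Pf// Pg// mulr0 addr0.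
  - move=> k f Pf s ks; rewrite -pairing_translate; apply: Pf => chi Vchi chic.
    by rewrite pairing_translate_character// ks// mulr0.
have VP : V `<=` P.
  apply: smallest_sub => // g Fg s ks.
  apply: (eberlein_synthesis varV) => //; first exact: sub_gen_smallest.
  exact: eF.
move=> f /VP Pf; apply: bipolar; first exact: smallest_linear_subspace.
move=> s sW; apply: Pf => chi Vchi chic; apply: sW; apply: sub_gen_smallest.
by split => //; exact: character_exponential_monomial.
Qed.

End synthesis.

(** * Integrals against complex measures *)

Section integral_bound.
Context d (T : measurableType d) (R : realType).
Local Notation C := R[i].

Definition bounded_measurable (f : T -> R) : Prop :=
  measurable_fun setT f /\ exists M, forall x, `|f x| <= M.

Lemma bounded_measurable_integrable (mu : {finite_measure set T -> \bar R}) f :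
  bounded_measurable f -> mu.-integrable setT (EFin \o f).
Proof.
move=> [mf [M fM]]; apply: measurable_bounded_integrable => //.
  by rewrite ltey_eq fin_num_measure.
exists M; split; first exact: num_real.
by move=> N MN x _; exact: le_trans (fM x) (ltW MN).
Qed.

Lemma bounded_measurable_lin a f g : bounded_measurable f ->
  bounded_measurable g -> bounded_measurable (fun x => a * f x + g x).
Proof.
move=> [mf [M fM]] [mg [N gN]]; split.
  by apply: measurable_funD => //; exact: measurable_funM.
exists (`|a| * M + N) => x; apply: le_trans (ler_normD _ _) _.
by rewrite normrM lerD// ler_wpM2l.
Qed.

Implicit Types (nu : {charge set T -> \bar R}) (mu : complex_measure T R).

Lemma charge_integral_lin nu a f g : bounded_measurable f ->
  bounded_measurable g ->
  charge_integral nu (fun x => a * f x + g x) =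
  a * charge_integral nu f + charge_integral nu g.
Proof.
move=> bf bg; rewrite /charge_integral.
have lin (mu : {finite_measure set T -> \bar R}) :
    \int[mu]_x (a * f x + g x) = a * \int[mu]_x f x + \int[mu]_x g x.
  rewrite RintegralD// ?RintegralZl//; try exact: bounded_measurable_integrable.
  apply: bounded_measurable_integrable.
  have b0 : bounded_measurable (fun=> 0).
    by split; [exact: measurable_cst|exists 0 => x; rewrite normr0].
  by have := bounded_measurable_lin a bf b0; under eq_fun do rewrite addr0.
rewrite !lin; ring.
Qed.

(** The constant is the total mass of the two parts of the Jordan
decomposition. *)
Lemma charge_integral_bound nu : exists2 c : R, 0 <= c &
  forall f M, bounded_measurable f -> (forall x, `|f x| <= M) ->
    `|charge_integral nu f| <= c * M.
Proof.
have bound (mu : {finite_measure set T -> \bar R}) f M : bounded_measurable f ->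
    (forall x, `|f x| <= M) -> `|\int[mu]_x f x| <= fine (mu setT) * M.
  move=> bf fM; have intf := bounded_measurable_integrable mu bf.
  apply: le_trans (le_normr_Rintegral _ intf) _ => //.
  rewrite mulrC -Rintegral_cst//; apply: le_Rintegral => //.
    exact: (integrable_norm intf).
  apply: bounded_measurable_integrable; split; first exact: measurable_cst.
  by exists `|M|.
rewrite /charge_integral; set P := jordan_pos _; set N := jordan_neg _.
exists (fine (P setT) + fine (N setT)); first by rewrite addr_ge0// fine_ge0.
move=> f M bf fM; rewrite mulrDl (le_trans (ler_normB _ _))//.
by rewrite lerD//; exact: bound.
Qed.

Definition complex_bounded_measurable (F : T -> C) : Prop :=
  bounded_measurable (fun x => complex.Re (F x)) /\
  bounded_measurable (fun x => complex.Im (F x)).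

Lemma Re_lin (z u v : C) :
  complex.Re (z * u + v) =
  complex.Re z * complex.Re u + (- complex.Im z * complex.Im u + complex.Re v).
Proof. by case: z u v => [z z'] [u u'] [v v'] /=; ring. Qed.

Lemma Im_lin (z u v : C) :
  complex.Im (z * u + v) =
  complex.Re z * complex.Im u + (complex.Im z * complex.Re u + complex.Im v).
Proof. by case: z u v => [z z'] [u u'] [v v'] /=; ring. Qed.

Lemma complex_bounded_measurable_lin z F H : complex_bounded_measurable F ->
  complex_bounded_measurable H ->
  complex_bounded_measurable (fun x => z * F x + H x).
Proof.
move=> [rF iF] [rH iH]; split.
  under eq_fun do rewrite Re_lin.
  by do 2 apply: bounded_measurable_lin => //.
under eq_fun do rewrite Im_lin.
by do 2 apply: bounded_measurable_lin => //.
Qed.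

Lemma complex_integral_lin mu z F H : complex_bounded_measurable F ->
  complex_bounded_measurable H ->
  complex_integral mu (fun x => z * F x + H x) =
  z * complex_integral mu F + complex_integral mu H.
Proof.
move=> [rF iF] [rH iH]; rewrite /complex_integral.
under eq_fun do rewrite Re_lin.
under [fun x => complex.Im (_ * _ + _)]eq_fun do rewrite Im_lin.
rewrite !charge_integral_lin//; try exact: bounded_measurable_lin.
case: z => z z'; apply/eqP; rewrite eq_complex /=.
by apply/andP; split; apply/eqP; ring.
Qed.

Lemma complex_integral_bound mu : exists2 c : R, 0 <= c &
  forall F (M : R), complex_bounded_measurable F ->
    (forall x, `|F x| <= M%:C) -> `|complex_integral mu F| <= (c * M)%:C.
Proof.
have [c c0 hc] := charge_integral_bound (re_part mu).
have [c' c'0 hc'] := charge_integral_bound (im_part mu).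
exists (2 * (c + c')); first by rewrite mulr_ge0// addr_ge0.
move=> F M [rF iF] FM.
have rM x : `|complex.Re (F x)| <= M.
  by rewrite -lecR; exact: le_trans (normc_ge_Re _) (FM x).
have iM x : `|complex.Im (F x)| <= M.
  by rewrite -lecR; exact: le_trans (normc_ge_Im _) (FM x).
rewrite [complex_integral mu F]complexE (le_trans (ler_normD _ _))//.
rewrite normrM norm_i mul1r !norm_real_complex -rmorphD lecR.
have -> : 2 * (c + c') * M = (c * M + c' * M) + (c * M + c' * M) by ring.
apply: lerD; first apply: le_trans (ler_normB _ _) _; last first.
  by apply: le_trans (ler_normD _ _) _; apply: lerD; [exact: hc|exact: hc'].
by apply: lerD; [exact: hc|exact: hc'].
Qed.

End integral_bound.

Section fourier_stieltjes_eberlein.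
Context {R : realType} {G : zmodType}.
Local Notation C := R[i].
Local Notation T := (borel (dual R G)).

(** The topology of the dual being initial, h is continuous on it, and its
Borel sets are generated by the open ones. *)
Lemma dual_continuous_measurable (h : cfun R G -> R) : continuous h ->
  measurable_fun setT (fun chi : T => h (chi : dual R G)).
Proof.
move=> ch; apply: (measurability _ (RGenOpens.measurableE R)).
move=> _ [_ [a [b ->] <-]]; rewrite setTI; apply: sub_sigma_algebra.
exists (h @^-1` `]a, b[%classic) => //.
by apply: open_comp => [f _|]; [exact: ch|exact: interval_open].
Qed.

Lemma point_complex_bounded_measurable (x : G) :
  complex_bounded_measurable (fun chi : T => (chi : dual R G) x).
Proof.
split; split.
- apply: (dual_continuous_measurable (h := fun f => complex.Re (f x))) => f.
  apply: (@continuous_comp (cfun R G) C^o R (fun f => f x)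
    (fun z => complex.Re z)).
    exact: point_continuous.
  exact: Re_continuous.
- exists 1 => chi; rewrite -lecR; apply: le_trans (normc_ge_Re _) _.
  by rewrite dual_norm.
- apply: (dual_continuous_measurable (h := fun f => complex.Im (f x))) => f.
  apply: (@continuous_comp (cfun R G) C^o R (fun f => f x)
    (fun z => complex.Im z)).
    exact: point_continuous.
  exact: Im_continuous.
- exists 1 => chi; rewrite -lecR; apply: le_trans (normc_ge_Im _) _.
  by rewrite dual_norm.
Qed.

(** By linearity, a measure s applied to the Fourier-Stieltjes transform of mu
is the integral of the trigonometric polynomial of s. *)
Lemma pairing_complex_integral (mu : complex_measure T R) (s : seq (C * G)) :
  complex_bounded_measurable (fun chi : T => pairing s (chi : dual R G)) /\
  pairing s (fun x => complex_integral mu (fun chi => (chi : dual R G) x)) =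
    complex_integral mu (fun chi : T => pairing s (chi : dual R G)).
Proof.
elim: s => [|p s [bs IH]].
  have -> : (fun chi : T => pairing [::] (chi : dual R G)) = (fun=> 0).
    by apply/funext => chi; rewrite pairing_nil.
  have b0 : complex_bounded_measurable (fun _ : T => 0 : C).
    by split; (split; [exact: measurable_cst|exists 0 => x; rewrite normr0]).
  split => //; rewrite pairing_nil.
  have := complex_integral_lin mu 1 b0 b0.
  by under eq_fun do rewrite mulr0 addr0; rewrite mul1r -[LHS]addr0 => /addrI.
have -> : (fun chi : T => pairing (p :: s) (chi : dual R G)) =
    (fun chi : T => p.1 * (chi : dual R G) p.2 + pairing s (chi : dual R G)).
  by apply/funext => chi; rewrite pairing_cons.
have bp := point_complex_bounded_measurable p.2.
split; first exact: complex_bounded_measurable_lin.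
by rewrite pairing_cons complex_integral_lin// IH.
Qed.

Lemma dual_character (chi : dual R G) : character chi.
Proof. by split=> [x|x y]; [exact: dual_norm|exact: dualD]. Qed.

Lemma fourier_stieltjes_eberlein f : fourier_stieltjes R G f -> eberlein f.
Proof.
move=> [mu _ ->]; have [c c0 muc] := complex_integral_bound mu.
exists c => // s M sM; have [bs ->] := pairing_complex_integral mu s.
by apply: muc => // chi; apply: sM; exact: dual_character.
Qed.

End fourier_stieltjes_eberlein.

(** * Synthesis of cocycles *)

Theorem theorem1p2 (R : realType) (X : metricType R) (A : set X)
    (A_neq0 : A !=set0) (A_discrete : uniformly_discrete A)
    (E : completeNormedModType R[i])
    (b : virtual_diagrams A -> virtual_diagrams A -> E)
    (b_cocycle : lipschitz_cocycle (@rho R X A) b)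
    (b_split : forall lam : {linear E -> R[i]^o}, continuous lam ->
      exists a f : cfun R (virtual_diagrams A),
        [/\ additive_fun a, fourier_stieltjes R (virtual_diagrams A) f &
            forall x, lam (b x 0) = a x + f x]) :
  synthesizable
    (smallest variety
      [set u : cfun R (virtual_diagrams A) |
        exists (h : virtual_diagrams A) (lam : {linear E -> R[i]^o}),
          continuous lam /\ u = fun x => lam (b h x)]).
Proof.
apply: eberlein_synthesizable => _ [h [lam [clam ->]]].
have [_ bD _] := b_cocycle.
have [a [f [aD /fourier_stieltjes_eberlein ef lamE]]] := b_split lam clam.
have -> : (fun x => lam (b h x)) = (fun x => -1 * f x + (1 * f (x + h) + a h)).
  apply/funext => x.
  have -> : b h x = b (h + x) 0 - b x 0 by rewrite bD add0r addrK.
  by rewrite raddfB/= !lamE aD [x + h]addrC; ring.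
apply: eberlein_lin => //; apply: eberlein_lin; last exact: eberlein_cst.
exact: eberlein_translate.
Qed.
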